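(* For every countable set $\mathcal H$ of infinitely edge-connected graphs there exists an outerplanar infinitely edge-connected graph that contains no member of $\mathcal H$ as a topological minor. Moreover, such a graph can be chosen to be a generalised halved Farey graph.
   Context: All graphs are simple. A graph (with at least two vertices) is infinitely edge-connected if no two of its vertices can be separated by deleting finitely many edges. A graph is outerplanar if it has a drawing with all vertices on the unit circle and all edges in the unit disc. $H$ is a topological minor of $G$ if $G$ contains a subdivision of $H$ as a subgraph. A generalised halved Farey graph of order $0$ is a non-trivial path with all edges coloured blue; a generalised halved Farey graph $G_{n+1}$ of order $n+1$ is obtained from one $G_n$ of order $n$ by adding, for every blue edge $e=uv$ of $G_n$, a blue $u$--$v$ path $P_e$ of length at least two which is internally disjoint from $G_n$ and from every other $P_{e'}$, and recolouring all edges of $G_n$ black. For any sequence $(G_n)_{n\in\mathbb N}$ obtained this way, the union $\bigcup_n G_n$ without colours is a generalised halved Farey graph. *)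

(* Defs.v *)
From HB Require Import structures.
From mathcomp Require Import all_boot all_order all_algebra.
From mathcomp Require Import all_classical all_reals topology normedtype.

Set Implicit Arguments.
Unset Strict Implicit.
Unset Printing Implicit Defensive.

Import Order.TTheory GRing.Theory Num.Theory.
Import numFieldNormedType.Exports.
Local Open Scope classical_set_scope.

(* Simple graphs, of arbitrary cardinality: edges are two-element sets. *)
Record graph := Graph {
  vertex :> Type;
  edges : set (set vertex);
  edges_pair : forall e, edges e -> exists x y, x <> y /\ e = [set x; y]
}.
Arguments edges : clear implicits.

(* A finite path on the distinct vertices [pt 0], ..., [pt plen]; the values of
   [pt] beyond [plen] are irrelevant. *)
Record gpath (V : Type) := GPath {
  plen : nat;
  pt : nat -> V;
  pt_inj : set_inj `I_plen.+1 pt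
}.

Section Paths.
Context {V : Type}.
Implicit Types P : gpath V.

Definition psource P : V := pt P 0.
Definition ptarget P : V := pt P (plen P).
Definition pends P : set V := [set psource P; ptarget P].
Definition pvertices P : set V := [set pt P i | i in `I_(plen P).+1].
Definition pinner P : set V :=
  [set pt P i | i in [set i | (0 < i < plen P)%N]].
Definition pedges P : set (set V) :=
  [set [set pt P i; pt P i.+1] | i in `I_(plen P)].

(* No path of the family has an inner vertex in [A] or on another path. *)
Definition internally_disjoint (I : Type) (A : set V) (P : I -> gpath V) :=
  (forall e, pinner (P e) `&` A = set0) /\
  (forall e e', e <> e' -> pinner (P e) `&` pvertices (P e') = set0).

Definition linked (E : set (set V)) (x y : V) :=
  exists P, [/\ psource P = x, ptarget P = y & pedges P `<=` E].

End Paths.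

Definition infinitely_edge_connected (G : graph) :=
  (exists x y : G, x <> y) /\
  forall x y : G, x <> y ->
  forall F : set (set G), F `<=` edges G -> finite_set F ->
  linked (edges G `\` F) x y.

(* [X] arises from [H] by replacing every edge by a path between (the copies
   of) its ends. *)
Definition is_subdivision (H X : graph) :=
  exists (phi : H -> X) (P : edges H -> gpath X),
    [/\ injective phi,
        forall e, pends (P e) = phi @` val e,
        internally_disjoint (range phi) P,
        [set: X] = range phi `|` \bigcup_e pvertices (P e) &
        edges X = \bigcup_e pedges (P e)].

(* [X] is isomorphic to a (not necessarily induced) subgraph of [G]. *)
Definition subgraph (X G : graph) :=
  exists f : X -> G, injective f /\ forall e, edges X e -> edges G (f @` e).

Definition topological_minor (H G : graph) :=
  exists X : graph, is_subdivision H X /\ subgraph X G.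

Section Outerplanar.
Variable R : realType.
Local Open Scope ring_scope.

Definition unit_circle : set (R * R) := [set p | p.1 ^+ 2 + p.2 ^+ 2 = 1].
Definition unit_disc : set (R * R) := [set p | p.1 ^+ 2 + p.2 ^+ 2 <= 1].

(* Vertices are drawn as distinct points and edges as arcs between their ends;
   the interior of an edge contains no vertex and no point of another edge. *)
Definition drawing (G : graph) (pos : G -> R * R)
    (arc : edges G -> R -> R * R) :=
  [/\ injective pos,
      forall e, {within `[0, 1], continuous (arc e)} /\
                set_inj `[0, 1] (arc e),
      forall e, [set arc e 0; arc e 1] = pos @` val e,
      forall e, (arc e @` `]0, 1[) `&` range pos = set0 &
      forall e e', e <> e' ->
        (arc e @` `]0, 1[) `&` (arc e' @` `[0, 1]) = set0].

Definition outerplanar (G : graph) :=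
  exists pos arc, [/\ @drawing G pos arc,
    range pos `<=` unit_circle &
    forall e, arc e @` `[0, 1] `<=` unit_disc].

End Outerplanar.

(* A subgraph of the complete graph on [V] with edges coloured black or blue. *)
Record colgraph (V : Type) := ColGraph {
  cvertices : set V;
  black : set (set V);
  blue : set (set V)
}.

Definition halved_Farey_start (V : Type) (S : colgraph V) :=
  exists P : gpath V, (0 < plen P)%N /\
    S = ColGraph (pvertices P) set0 (pedges P).

Definition halved_Farey_step (V : Type) (S S' : colgraph V) :=
  exists P : blue S -> gpath V,
    [/\ forall e, pends (P e) = val e,
        forall e, (2 <= plen (P e))%N,
        internally_disjoint (cvertices S) P &
        S' = ColGraph (cvertices S `|` \bigcup_e pvertices (P e))
                      (black S `|` blue S)
                      (\bigcup_e pedges (P e))].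

Definition generalised_halved_Farey (G : graph) :=
  exists S : nat -> colgraph G,
    [/\ halved_Farey_start (S 0),
        forall n, halved_Farey_step (S n) (S n.+1),
        [set: G] = \bigcup_n cvertices (S n) &
        edges G = \bigcup_n (black (S n) `|` blue (S n))].

(* Main.v *)
(* The vertices of G are the fractions k / L_n in [0, 1], where L_0 = 1 and
   L_(n+1) = L_n c_n, and the edges of order n join k / L_n to (k+1) / L_n.
   Placing the vertices on the circle in their order on the line gives a drawing
   by non-crossing chords.

   In every infinitely edge-connected H of the family fix vertices a <> b and
   pairwise edge-disjoint a-b paths Q_0, Q_1, ...  Suppose that H is a
   topological minor of G, and let m be large. At most N = (m+1) L_m edges of G
   have order at most m, so two of the paths Q_0, ..., Q_(2N+1) are mapped to
   paths of G that avoid all these edges. Both then pass through every fraction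
   of denominator L_(m+1) between the images of a and b; since they come from
   edge-disjoint paths of H, all these fractions are branch vertices. There are
   at least c_m - 1 of them, which is impossible if c_m is large compared with
   the lengths of Q_0, ..., Q_(2N+1). As N only depends on L_m, the c_m can be
   chosen recursively so that this eventually holds for each of the countably
   many members of the family. *)

Require Import Defs.
From mathcomp Require Import all_boot all_order all_algebra.
From mathcomp Require Import all_classical all_reals topology normedtype.
From mathcomp Require Import ring lra zify.

Set Implicit Arguments.
Unset Strict Implicit.
Unset Printing Implicit Defensive.

Import Order.TTheory GRing.Theory Num.Theory.
Import numFieldNormedType.Exports.
Local Open Scope classical_set_scope.

(** * Drawing a non-crossing graph in the disc *)

Section Chords.
Variable R : realType.
Local Open Scope ring_scope.
Implicit Types (s t u z : R) (p q : R * R).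

(** The rational parametrisation of the circle without [(-1, 0)]; it turns the order of the line
    into the cyclic order. *)
Definition circle_point z : R * R :=
  ((1 - z ^+ 2) / (1 + z ^+ 2), 2 * z / (1 + z ^+ 2)).

Definition segment p q t : R * R :=
  ((1 - t) * p.1 + t * q.1, (1 - t) * p.2 + t * q.2).

(* The affine form vanishing on the chord between the points [s] and [t]. *)
Definition chord_form s t p : R :=
  (1 - p.1) - (s + t) * p.2 + s * t * (1 + p.1).

Lemma sqrD1_gt0 z : 0 < 1 + z ^+ 2.
Proof. by rewrite ltr_pwDl // sqr_ge0. Qed.

Lemma sqrD1_neq0 z : 1 + z ^+ 2 != 0.
Proof. by rewrite gt_eqF // sqrD1_gt0. Qed.

Lemma circle_pointP z : unit_circle (circle_point z).
Proof.
rewrite /unit_circle /=; have := sqrD1_neq0 z => h; field; exact: h.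
Qed.

Lemma circle_point_inj : injective circle_point.
Proof.
move=> s t [h1 h2].
have hs := sqrD1_neq0 s; have ht := sqrD1_neq0 t.
have e : (1 + s ^+ 2)^-1 = (1 + t ^+ 2)^-1.
  have E z : 1 + z ^+ 2 != 0 ->
      (1 + z ^+ 2)^-1 = ((1 - z ^+ 2) / (1 + z ^+ 2) + 1) / 2.
    by move=> hz; field.
  by rewrite (E s hs) (E t ht) h1.
move: h2; rewrite e => /(mulIf (invr_neq0 ht)).
by apply: mulfI; rewrite pnatr_eq0.
Qed.

(** The sign of [(z - s) * (z - t)] tells on which side of the chord a point of the circle lies. *)
Lemma chord_form_circle s t z :
  chord_form s t (circle_point z) = (z - s) * (z - t) * (2 / (1 + z ^+ 2)).
Proof. rewrite /chord_form /=; have h := sqrD1_neq0 z; field; exact: h. Qed.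

Lemma chord_form_segment s t p q u :
  chord_form s t (segment p q u) =
  (1 - u) * chord_form s t p + u * chord_form s t q.
Proof. rewrite /chord_form /segment /=; ring. Qed.

Lemma chord_form_ends s t u :
  chord_form s t (segment (circle_point s) (circle_point t) u) = 0.
Proof.
by rewrite chord_form_segment !chord_form_circle !subrr !(mul0r, mulr0, addr0).
Qed.

Lemma chord_form_ge0 s t z : s <= t -> ~~ (s < z < t) ->
  0 <= chord_form s t (circle_point z).
Proof.
move=> st; rewrite chord_form_circle => h; apply: mulr_ge0; last first.
  by rewrite divr_ge0 // ltW // sqrD1_gt0.
move: h; rewrite negb_and -!leNgt => /orP[zs|tz].
  by apply: mulr_le0; rewrite subr_le0 // (le_trans zs).
by apply: mulr_ge0; rewrite subr_ge0 // (le_trans st).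
Qed.

Lemma chord_form_eq0 s t z : chord_form s t (circle_point z) = 0 ->
  z = s \/ z = t.
Proof.
rewrite chord_form_circle => /eqP; rewrite !mulf_eq0 invr_eq0.
rewrite (negbTE (sqrD1_neq0 z)) pnatr_eq0 !orbF !subr_eq0.
by case/orP => /eqP; [left|right].
Qed.

(* The form is nonnegative at both ends of the second chord, so a zero in its
   interior forces zeros at both ends. *)
Lemma chord_form_inner s t s' t' u : s <= t -> 0 < u < 1 ->
  ~~ (s < s' < t) -> ~~ (s < t' < t) ->
  chord_form s t (segment (circle_point s') (circle_point t') u) = 0 ->
  (s' = s \/ s' = t) /\ (t' = s \/ t' = t).
Proof.
move=> st /andP[u0 u1] hs ht; rewrite chord_form_segment.
have A := chord_form_ge0 st hs; have B := chord_form_ge0 st ht.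
have u1' : 0 < 1 - u by rewrite subr_gt0.
move/eqP; rewrite paddr_eq0 ?mulr_ge0 ?(ltW u0) ?(ltW u1') //.
rewrite !mulf_eq0 (gt_eqF u0) (gt_eqF u1') /= => /andP[/eqP a /eqP b].
by split; apply: chord_form_eq0.
Qed.

(** Strict convexity of the disc in one identity: the subtracted term is nonnegative on [[0, 1]],
    and positive inside if the ends differ. *)
Lemma segment_norm p q u : unit_circle p -> unit_circle q ->
  (segment p q u).1 ^+ 2 + (segment p q u).2 ^+ 2 =
  1 - u * (1 - u) * ((p.1 - q.1) ^+ 2 + (p.2 - q.2) ^+ 2).
Proof.
rewrite /unit_circle /segment /= => hp hq.
have hp' : p.1 ^+ 2 = 1 - p.2 ^+ 2 by rewrite -hp addrK.
have hq' : q.1 ^+ 2 = 1 - q.2 ^+ 2 by rewrite -hq addrK.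
ring: hp' hq'.
Qed.

Lemma segment_disc p q u : unit_circle p -> unit_circle q ->
  0 <= u <= 1 -> unit_disc (segment p q u).
Proof.
move=> hp hq /andP[u0 u1]; rewrite /unit_disc /= segment_norm //.
by rewrite gerBl !mulr_ge0 ?subr_ge0 // addr_ge0 ?sqr_ge0.
Qed.

Lemma segment_notin_circle p q u : unit_circle p -> unit_circle q ->
  p <> q -> 0 < u < 1 -> ~ unit_circle (segment p q u).
Proof.
move=> hp hq pq /andP[u0 u1]; rewrite /unit_circle /= segment_norm //.
move/eqP; rewrite -subr_eq0 addrAC subrr add0r oppr_eq0 !mulf_eq0.
rewrite (gt_eqF u0) subr_eq0 (gt_eqF u1) /= paddr_eq0 ?sqr_ge0 //.
rewrite !sqrf_eq0 !subr_eq0 => /andP[/eqP a /eqP b]; apply: pq.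
by case: p q a b {hp hq} => [? ?] [? ?] /= -> ->.
Qed.

Lemma segment0 p q : segment p q 0 = p.
Proof.
by rewrite /segment subr0 !mul1r !mul0r !addr0 -surjective_pairing.
Qed.

Lemma segment1 p q : segment p q 1 = q.
Proof.
by rewrite /segment subrr !mul1r !mul0r !add0r -surjective_pairing.
Qed.

Lemma segment_inj p q : p <> q -> injective (segment p q).
Proof.
move=> pq u t [/eqP a /eqP b].
have [//|/eqP ut] := eqVneq u t; case: pq.
have utn : u - t != 0 by rewrite subr_eq0; apply/eqP.
have key (x y : R) : (1 - u) * x + u * y == (1 - t) * x + t * y -> x = y.
  rewrite -subr_eq0.
  rewrite (_ : _ - _ = (u - t) * (y - x)); last by ring.
  by rewrite mulf_eq0 (negbTE utn) subr_eq0 => /eqP.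
by move: p q a b => [? ?] [? ?] /= /key -> /key ->.
Qed.

Lemma segment_continuous p q : continuous (segment p q).
Proof.
move=> t; rewrite /segment.
have lin (x y : R) : (1 - u) * x + u * y @[u --> t] --> (1 - t) * x + t * y.
  by apply: cvgD; apply: cvgMl; [apply: cvgB; [exact: cvg_cst|]|]; exact: cvg_id.
exact: cvg_pair (lin _ _) (lin _ _).
Qed.

End Chords.

(** * Outerplanarity from a non-crossing order *)

Section NonCrossing.
Variables (R : realType) (G : graph) (h : G -> R).
Local Open Scope ring_scope.
Hypothesis h_inj : injective h.
Hypothesis h_noncrossing : forall x y x' y' : G,
  edges G [set x; y] -> edges G [set x'; y'] ->
  ~~ [&& h x < h x', h x' < h y & h y < h y'].

Lemma edge_ordered (e : edges G) : exists xy : G * G,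
  h xy.1 < h xy.2 /\ val e = [set xy.1; xy.2].
Proof.
have [x [y [xy eE]]] := edges_pair (set_valP e).
have [ltxy|ltyx|/h_inj//] := ltgtP (h x) (h y).
  by exists (x, y).
by exists (y, x); split=> //; rewrite setUC.
Qed.

(** Edges are drawn as straight chords. For two edges, one of the two open intervals contains no end
    of the other edge, so [chord_form_inner] applies if the chords meet. *)
Lemma outerplanar_noncrossing : outerplanar R G.
Proof.
have [end_ endP] := choice edge_ordered.
pose pos x := circle_point (h x).
pose arc (e : edges G) := segment (pos (end_ e).1) (pos (end_ e).2).
have pos_inj : injective pos by move=> x y /circle_point_inj /h_inj.
have pos_circle x : unit_circle (pos x) by apply: circle_pointP.
have arcn e : pos (end_ e).1 <> pos (end_ e).2.
  by case: (endP e) => lt _ /pos_inj E; rewrite E ltxx in lt.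
have inner e t : 0 < t < 1 -> ~ unit_circle (arc e t).
  by move=> ?; apply: segment_notin_circle.
have arc0 e : arc e 0 = pos (end_ e).1 by apply: segment0.
have arc1 e : arc e 1 = pos (end_ e).2 by apply: segment1.
exists pos, arc; split.
- split=> //.
  + move=> e; split; first exact/continuous_subspaceT/segment_continuous.
    by move=> s t _ _; apply: segment_inj.
  + by move=> e; rewrite (endP e).2 image_setU !image_set1 arc0 arc1.
  + move=> e; rewrite -subset0 => _ [[t + <-] [x _ E]].
    by rewrite /= in_itv /= => /(inner e); apply; rewrite -E.
  + move=> e e' ee'; rewrite -subset0 => _ [[t + <-] [t' + E]].
    rewrite /= !in_itv /= => t01 /andP[t'0 t'1].
    have [lt eE] := endP e; have [lt' eE'] := endP e'.
    have ends_eq : ((end_ e).1 = (end_ e').1 /\ (end_ e).2 = (end_ e').2) ->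
        False.
      by move=> [a b]; apply: ee'; apply: val_inj; rewrite eE eE' a b.
    have ge := set_valP e; have ge' := set_valP e'.
    move: ge ge'; rewrite eE eE' => ge ge'.
    have C1 := h_noncrossing ge ge'; have C2 := h_noncrossing ge' ge.
    (* At an end of the second chord, the common point would be an inner point of the first chord
       lying on the circle. *)
    have t'01 : 0 < t' < 1.
      rewrite !lt_neqAle t'0 t'1 !andbT eq_sym; apply/andP; split;
        apply/eqP => tt; apply: (inner e t t01); move: E.
        by rewrite tt arc0 => <-.
      by rewrite tt arc1 => <-.
    have lem (x y x' y' : G) u u' : h x < h y -> h x' < h y' -> 0 < u' < 1 ->
        ~~ (h x < h x' < h y) -> ~~ (h x < h y' < h y) ->
        segment (pos x') (pos y') u' = segment (pos x) (pos y) u ->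
        x = x' /\ y = y'.
      move=> xy xy' u01 nx ny EE.
      have := chord_form_inner (ltW xy) u01 nx ny.
      rewrite -!/(pos _) EE chord_form_ends => /(_ erefl) [a b].
      move: a b xy'; case=> [/h_inj->|/h_inj->]; case=> [/h_inj->|/h_inj->];
        rewrite ?ltxx //.
      by move=> l; have := lt_trans xy l; rewrite ltxx.
    have [A|] := boolP (~~ (h (end_ e).1 < h (end_ e').1 < h (end_ e).2) &&
                       ~~ (h (end_ e).1 < h (end_ e').2 < h (end_ e).2)).
      by case/andP: A => A1 A2; apply: ends_eq; apply: lem A1 A2 E.
    (* Some end of [e'] is strictly inside the interval of [e]; non-crossing then keeps both ends of
       [e] out of the open interval of [e'], so the roles are exchanged. *)
    move=> B; apply: ends_eq.
    suff [-> ->] : (end_ e').1 = (end_ e).1 /\ (end_ e').2 = (end_ e).2 by [].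
    apply: (lem _ _ _ _ t' t) => //.
    + by apply: contra B => ?; move: C1 C2; lra.
    + by apply: contra B => ?; move: C1 C2; lra.
- by move=> _ [x _ <-].
- move=> e _ [t + <-]; rewrite /= in_itv /=; exact: segment_disc.
Qed.

End NonCrossing.

(** * The graph of fractions *)

Lemma set2_eq (T : Type) (x y x' y' : T) : [set x; y] = [set x'; y'] ->
  (x = x' /\ y = y') \/ (x = y' /\ y = x').
Proof.
move=> E.
have hx : [set x'; y'] x by rewrite -E; left.
have hy : [set x'; y'] y by rewrite -E; right.
have hx' : [set x; y] x' by rewrite E; left.
have hy' : [set x; y] y' by rewrite E; right.
by move: hx hy hx' hy' => /= [->|->] [->|->] [] ? [] ?; subst; auto.
Qed.

Lemma linked_sym (V : Type) (E : set (set V)) x y : linked E x y -> linked E y x.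
Proof.
move=> [P [sP tP PE]].
have inj : set_inj `I_(plen P).+1 (fun i => pt P (plen P - i)%N).
  move=> i j /set_mem /= iP /set_mem /= jP ij.
  have iP' : (plen P - i)%N \in `I_(plen P).+1 by rewrite inE /=; lia.
  have jP' : (plen P - j)%N \in `I_(plen P).+1 by rewrite inE /=; lia.
  by have := pt_inj iP' jP' ij; lia.
exists (GPath inj); split.
- by rewrite /psource /= subn0.
- by rewrite /ptarget /= subnn.
- move=> _ [i /= iP <-]; apply: PE; exists (plen P - i.+1)%N => /=; first lia.
  by rewrite setUC; congr [set pt P _; pt P _]; lia.
Qed.

Section Farey.
Variables (R : realType) (L c : nat -> nat).

Local Open Scope ring_scope.

(** Capping the index at [L n] makes every [node n k] a vertex, with no bound on [k] to carry
    along. *)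
Definition grid n k : R := (minn k (L n))%:R / (L n)%:R.

(* A record, since the universe of [set_type] is too large for the vertices of
   a [graph] when one also quantifies over sets of graphs. *)
Record farey_vertex : Type := FareyVertex {
  coord : R;
  coord_grid : exists n k, coord = grid n k
}.

Definition node n k : farey_vertex :=
  FareyVertex (ex_intro _ n (ex_intro _ k erefl)).

Definition nodes n : set farey_vertex := [set node n k | k in `I_(L n).+1].

Definition level n : set (set farey_vertex) :=
  [set [set node n k; node n k.+1] | k in `I_(L n)].

Lemma coord_inj : injective coord.
Proof.
move=> [x xP] [y yP] /= E; rewrite E in xP *.
by congr FareyVertex; apply: Prop_irrelevance.
Qed.

Lemma coord_node n k : (k <= L n)%N -> coord (node n k) = k%:R / (L n)%:R.
Proof. by move=> /minn_idPl E; rewrite /coord /= /grid E. Qed.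

Lemma coord_lt n k j : (k <= L n)%N -> (j <= L n)%N ->
  (coord (node n k) < coord (node n j)) = (k < j)%N.
Proof.
move=> kL jL; rewrite !coord_node //.
have [L0|L_gt0] := posnP (L n).
  by move: kL jL; rewrite L0 !leqn0 => /eqP-> /eqP->; rewrite ltxx ltnn.
by rewrite ltr_pM2r ?ltr_nat // invr_gt0 ltr0n.
Qed.

Lemma node_inj n k j : (k <= L n)%N -> (j <= L n)%N ->
  node n k = node n j -> k = j.
Proof.
move=> kL jL E; have := coord_lt kL jL; have := coord_lt jL kL.
by rewrite E !ltxx; case: ltngtP.
Qed.

Lemma level_pair e : (\bigcup_n level n) e ->
  exists x y, x <> y /\ e = [set x; y].
Proof.
move=> [n _ [k /= kL <-]]; exists (node n k), (node n k.+1); split=> //.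
by move=> /node_inj => /(_ (ltnW kL) kL); lia.
Qed.

Definition farey_graph : graph := Graph level_pair.

Lemma nodes_cover x : exists n, nodes n x.
Proof.
have [n [k E]] := coord_grid x; exists n, (minn k (L n)) => /=.
  by rewrite ltnS geq_minr.
by apply: coord_inj; rewrite E /= /grid -minnA minnn.
Qed.

Definition node_path n k l (klL : (k + l <= L n)%N) : gpath farey_vertex.
Proof.
exists l (fun i => node n (k + i)).
abstract (move=> i j /set_mem /= il /set_mem /= jl /node_inj; lia).
Defined.

Hypothesis LS : forall n, L n.+1 = (L n * c n)%N.
Hypothesis c_gt1 : forall n, (1 < c n)%N.

Lemma nodeS n k : (k <= L n)%N -> node n k = node n.+1 (k * c n).
Proof.
move=> kL; apply: coord_inj; rewrite !coord_node ?LS ?leq_mul2r ?kL ?orbT //.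
have c0 : (c n)%:R != 0 :> R by rewrite pnatr_eq0; have := c_gt1 n; lia.
by rewrite !natrM -mulf_div divff // mulr1.
Qed.

Lemma child_bound n k : (k < L n)%N -> (k * c n + c n <= L n.+1)%N.
Proof. by move=> kL; rewrite LS addnC -mulSn leq_mul2r kL orbT. Qed.

Lemma L_mono n m : (n <= m)%N -> (L n <= L m)%N.
Proof.
move=> /subnKC<-; elim: (m - n)%N => [|d IH]; first by rewrite addn0.
by rewrite addnS LS (leq_trans IH) // leq_pmulr // ltnW.
Qed.

Lemma nodes_sub n m : (n <= m)%N -> nodes n `<=` nodes m.
Proof.
move=> /subnKC<-; elim: (m - n)%N => [|d IH]; first by rewrite addn0.
move=> x /IH [k /= kL <-]; rewrite addnS.
exists (k * c (n + d))%N; last by rewrite -nodeS.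
by rewrite /= ltnS LS leq_mul2r -ltnS kL orbT.
Qed.

(** Fractions of level [n] are also fractions of level [m], where [k] and [k.+1] are consecutive.
    Planarity and the exclusion of minors both rest on this. *)
Lemma nodes_between n m k p : (n <= m)%N -> (k < L m)%N -> nodes n p ->
  ~~ (coord (node m k) < coord p < coord (node m k.+1)).
Proof.
move=> nm kL /(nodes_sub nm) [j /= jL <-].
by rewrite !coord_lt //; lia.
Qed.

Lemma level_ordered n x y : level n [set x; y] -> coord x < coord y ->
  exists2 k, (k < L n)%N & x = node n k /\ y = node n k.+1.
Proof.
move=> [k /= kL E]; have [[<- <-]|[<- <-]] := set2_eq E; first by exists k.
by rewrite coord_lt //; lia.
Qed.

Lemma level_nodes n e x : level n e -> e x -> nodes n x.
Proof.
move=> [k /= kL <-] [->|->]; [exists k|exists k.+1] => //=; lia.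
Qed.

(** As [c n > 1], some vertex of level [n.+1] lies strictly between the ends of an edge of level
    [n], but none does for an edge of level [m]. *)
Lemma level_ltn_disjoint n m e : (n < m)%N -> level n e -> ~ level m e.
Proof.
move=> nm [k /= kL <-]; have kL1 : (k.+1 <= L n)%N by [].
move=> /level_ordered []; first by rewrite coord_lt // ltnW.
move=> j jL [E1 E2].
have kb := child_bound kL; have cn := c_gt1 n.
have pn : nodes n.+1 (node n.+1 (k * c n).+1) by exists (k * c n).+1 => //=; lia.
have := nodes_between nm jL pn; rewrite -E1 -E2 (nodeS (ltnW kL)) (nodeS kL1).
by rewrite mulSn !coord_lt //; lia.
Qed.

Lemma level_inj n m e : level n e -> level m e -> n = m.
Proof.
move=> en em; have [nm|mn|//] := ltngtP n m.
  by case: (level_ltn_disjoint nm en).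
by case: (level_ltn_disjoint mn em).
Qed.

(** A discrete intermediate value principle: along edges of level at least [n], one changes sides of
    [p] only by visiting [p]. *)
Lemma level_side n m x y p : (n <= m)%N -> level m [set x; y] -> nodes n p ->
  p <> x -> p <> y -> (coord x < coord p) = (coord y < coord p).
Proof.
move=> nm; wlog xy : x y / coord x < coord y => [W|] e pn px py.
  have [lt|lt|/coord_inj-> //] := ltgtP (coord x) (coord y); first exact: W.
  by apply/esym; apply: W; rewrite // setUC.
have [k kL [E1 E2]] := level_ordered e xy.
have := nodes_between nm kL pn; rewrite -E1 -E2.
have nx : coord p != coord x by apply/eqP => /coord_inj.
have ny : coord p != coord y by apply/eqP => /coord_inj.
by move: nx ny xy; case: (ltgtP (coord x) (coord p));
  case: (ltgtP (coord y) (coord p)) => //=; lra.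
Qed.

(** If two edges crossed, one whose level is at least that of the other would have an end of the
    other strictly between its own ends. *)
Lemma farey_outerplanar : outerplanar R farey_graph.
Proof.
apply: (@outerplanar_noncrossing R farey_graph coord coord_inj).
move=> x y x' y' [n _ e] [m _ e']; apply/negP => /and3P[h1 h2 h3].
have [k kL [E1 E2]] := level_ordered e (lt_trans h1 h2).
have [k' kL' [E1' E2']] := level_ordered e' (lt_trans h2 h3).
have [nm|/ltnW mn] := leqP n m.
  have := nodes_between nm kL' (level_nodes e (or_intror erefl)).
  by rewrite -E1' -E2' h2 h3.
have := nodes_between mn kL (level_nodes e' (or_introl erefl)).
by rewrite -E1 -E2 h1 h2.
Qed.

Lemma finite_levels (F : set (set farey_vertex)) :
  F `<=` edges farey_graph -> finite_set F ->
  exists N, forall m, (N <= m)%N -> level m `&` F = set0.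
Proof.
move=> FE /finite_seqP[s Fs]; rewrite {}Fs in FE *.
elim: s FE => [|e s IH] FE.
  by exists 0%N => m _; rewrite -subset0 => x [].
have [|N HN] := IH; first by move=> d ds; apply: FE; rewrite /= inE ds orbT.
have [n _ en] : edges farey_graph e by apply: FE; rewrite /= inE eqxx.
exists (maxn N n.+1) => m; rewrite geq_max => /andP[Nm nm].
rewrite -subset0 => d [dm /=]; rewrite inE => /orP[/eqP de|ds].
  by have := level_inj en; rewrite -de => /(_ _ dm); lia.
by have : (level m `&` [set` s]) d by []; rewrite HN.
Qed.

Definition farey_stage n : colgraph farey_vertex :=
  ColGraph (nodes n) (\bigcup_(m in `I_n) level m) (level n).

(** Edge [k] is replaced by the path through the indices [k * c n] to [k * c n + c n] of level
    [n.+1]; division by [c n] recovers the edge from an index. *)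
Lemma farey_stage_step n : halved_Farey_step (farey_stage n) (farey_stage n.+1).
Proof.
have idx (e : level n) : exists k : nat, (k < L n)%N /\
    val e = [set node n k; node n k.+1].
  by have [k /= kL E] := set_valP e; exists k; split; rewrite ?E.
have [ix ixP] := choice idx.
have cn0 : (0 < c n)%N := ltnW (c_gt1 n).
pose P (e : level n) := node_path (child_bound (ixP e).1).
have bound (e : level n) i : (i <= c n)%N -> (ix e * c n + i <= L n.+1)%N.
  by move=> ic; have := child_bound (ixP e).1; lia.
have split_ix j : (j < L n.+1)%N -> exists e : level n, exists2 i,
    (i < c n)%N & j = (ix e * c n + i)%N.
  rewrite LS => jL; have kL : (j %/ c n < L n)%N by rewrite ltn_divLR.
  have lev : level n [set node n (j %/ c n); node n (j %/ c n).+1].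
    by exists (j %/ c n)%N.
  pose e : level n := SigSub (mem_set lev).
  exists e, (j %% c n)%N; first by rewrite ltn_mod.
  suff -> : ix e = (j %/ c n)%N by apply: divn_eq.
  have [kL' E] := ixP e; have [[Ek _]|[E1 E2]] := set2_eq E.
    by rewrite (node_inj _ _ Ek) // ltnW.
  have := node_inj (ltnW kL) kL' E1; have := node_inj kL (ltnW kL') E2; lia.
exists P; split.
- move=> e; rewrite /pends /psource /ptarget /= (ixP e).2 addn0.
  have kL := (ixP e).1.
  by rewrite (nodeS (ltnW kL)) (nodeS kL) mulSn addnC.
- by move=> e; apply: c_gt1.
- split=> [e|e e' ee']; rewrite -subset0 => _ [[i /= /andP[i0 ic] <-]].
    have kL := (ixP e).1.
    move=> /(nodes_between (leqnn n) kL).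
    rewrite (nodeS (ltnW kL)) (nodeS kL) mulSn.
    have := child_bound kL => kb.
    by rewrite !coord_lt //; lia.
  move=> [i' /= i'c E]; apply: ee'; apply: val_inj.
  rewrite (ixP e).2 (ixP e').2.
  have {}E := node_inj (bound e' i' i'c) (bound e i (ltnW ic)) E.
  suff -> : ix e = ix e' by [].
  have [lt|lt|//] := ltngtP (ix e) (ix e').
    by have := leq_mul2r (c n) (ix e).+1 (ix e'); rewrite mulSn; lia.
  by have := leq_mul2r (c n) (ix e').+1 (ix e); rewrite mulSn; lia.
- congr ColGraph.
  + rewrite eqEsubset; split=> [_ [j /= jL <-]|x [|[e _ [i /= ic <-]]]].
    (* The last index [L n.+1] begins no edge and so escapes [split_ix]; it is the old vertex with
       index [L n]. *)
    * rewrite ltnS leq_eqVlt in jL; case/orP: jL => [/eqP->|/split_ix].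
        by left; exists (L n) => //=; rewrite nodeS // LS.
      move=> [e [i ic ->]]; right; exists e => //; exists i => //=; lia.
    * exact: nodes_sub.
    * by exists (ix e * c n + i)%N => //=; rewrite ltnS bound.
  + rewrite eqEsubset; split=> [e [m /= mn em]|e [[m /= mn em]|en]].
    * rewrite ltnS leq_eqVlt in mn; case/orP: mn => [/eqP<-|mn]; first by right.
      by left; exists m.
    * by exists m => //=; rewrite ltnW.
    * by exists n => /=.
  + rewrite eqEsubset; split=> [_ [j /= jL <-]|_ [e _ [i /= ic <-]]].
      have [e [i ic ->]] := split_ix j jL.
      by exists e => //; exists i => //=; rewrite addnS.
    exists (ix e * c n + i)%N; rewrite /= ?addnS //.
    by rewrite -addnS bound.
Qed.

Hypothesis L0 : L 0 = 1%N.

(** The edges of one level form a path through all its vertices, so a level that avoids [F] and is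
    late enough to contain [x] and [y] links them. *)
Lemma farey_connected : infinitely_edge_connected farey_graph.
Proof.
split.
  exists (node 0 0), (node 0 1) => /node_inj; rewrite L0; lia.
move=> x y xy F FE finF.
have [N HN] := finite_levels FE finF.
have [n xn] := nodes_cover x; have [n' yn] := nodes_cover y.
pose m := maxn N (maxn n n').
have xm : nodes m x by apply: nodes_sub xn; rewrite /m; lia.
have ym : nodes m y by apply: nodes_sub yn; rewrite /m; lia.
have {HN} HN : level m `&` F = set0 by apply: HN; rewrite /m; lia.
move: xm ym => [i /= iL Ex] [j /= jL Ey].
have link a b : (a <= b)%N -> (b <= L m)%N ->
    linked (edges farey_graph `\` F) (node m a) (node m b).
  move=> ab bL; have abL : (a + (b - a) <= L m)%N by rewrite subnKC.
  exists (node_path abL); split.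
  - by rewrite /psource /= addn0.
  - by rewrite /ptarget /= subnKC.
  - move=> _ [k /= kl <-].
    have lev : level m [set node m (a + k); node m (a + k.+1)].
      by exists (a + k)%N; rewrite /= ?addnS //; lia.
    split; first by exists m.
    by move=> Fk; have : (level m `&` F) [set node m (a + k); node m (a + k.+1)] by []; rewrite HN.
rewrite -Ex -Ey; have [ij|/ltnW ji] := leqP i j; first by apply: link; lia.
by apply: linked_sym; apply: link; lia.
Qed.

Lemma farey_generalised : generalised_halved_Farey farey_graph.
Proof.
exists farey_stage; split.
- have bd : (0 + L 0 <= L 0)%N by [].
  exists (node_path bd); split; first by rewrite /= L0.
  congr ColGraph.
  by rewrite -subset0 => e [m].
- exact: farey_stage_step.
- rewrite eqEsubset; split=> // x _.
  by have [n xn] := nodes_cover x; exists n.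
- rewrite eqEsubset; split=> e [n _ en]; first by exists n => //; right.
  by case: en => [[m _ em]|em]; [exists m|exists n].
Qed.

End Farey.

(** * Topological minors *)

Lemma injective_image (T U : Type) (f : T -> U) : injective f ->
  injective (fun A : set T => f @` A).
Proof.
move=> f_inj A B AB; apply/seteqP; split=> x.
  by rewrite -(image_inj f_inj) AB image_inj.
by rewrite -(image_inj f_inj) -AB image_inj.
Qed.

Section Subdivision.
Variables (H X : graph) (phi : H -> X) (P : edges H -> gpath X).
Hypothesis phi_inj : injective phi.
Hypothesis P_ends : forall e, pends (P e) = phi @` val e.
Hypothesis P_disj : internally_disjoint (range phi) P.

(** If [e] and [e'] differed, no end of [d] would be inner on either path, so [d] would be the whole
    of both. Then [e] and [e'] have the same ends, and [H] is simple. *)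
Lemma subdivision_edge_inj e e' d :
  pedges (P e) d -> pedges (P e') d -> e = e'.
Proof.
move=> de de'; have [//|/eqP ee'] := eqVneq e e'.
have key f f' : f <> f' -> pedges (P f) d -> pedges (P f') d ->
    d = pends (P f).
  move=> ff' [i /= il <-] [j /= jl E].
  have no k : (0 < k < plen (P f))%N -> [set pt (P f) i; pt (P f) i.+1] (pt (P f) k) -> False.
    rewrite -E => kl kE.
    have : (pinner (P f) `&` pvertices (P f')) (pt (P f) k).
      split; first by exists k.
      case: kE => ->; [exists j|exists j.+1] => //=; lia.
    by rewrite (P_disj.2 _ _ ff').
  have i0 : i = 0%N.
    by case: i il {E} no => // i il /(_ i.+1 _) no; case: no; [lia|left].
  have il1 : i.+1 = plen (P f).
    apply/eqP; rewrite eqn_leq il /= leqNgt; apply/negP => lt.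
    by apply: (no i.+1); [rewrite lt|right].
  by rewrite /pends /psource /ptarget -il1 i0.
have E := key e e' ee' de de'.
have E' := key e' e (fun h => ee' (esym h)) de' de.
apply: val_inj; apply: (injective_image phi_inj).
by rewrite -!P_ends -E -E'.
Qed.

Lemma subdivision_branch e e' x : e <> e' ->
  pvertices (P e) x -> pvertices (P e') x -> exists2 h, val e h & x = phi h.
Proof.
move=> ee' [i /= il <-] xe'.
have : pends (P e) (pt (P e) i).
  have [->|i0] := posnP i; first by left.
  have [lt|ge] := ltnP i (plen (P e)); last first.
    by right; rewrite /ptarget /=; congr pt; lia.
  have : (pinner (P e) `&` pvertices (P e')) (pt (P e) i).
    by split=> //; exists i => //=; rewrite i0.
  by rewrite (P_disj.2 _ _ ee').
by rewrite P_ends => -[h he <-]; exists h.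
Qed.

End Subdivision.

(** * Paths and families of edge-disjoint paths *)

Lemma path_invariant (V : Type) (P : gpath V) (s : V -> bool) :
  (forall x y, pedges P [set x; y] -> s x = s y) ->
  forall x y, pvertices P x -> pvertices P y -> s x = s y.
Proof.
move=> sE.
have s0 i : (i <= plen P)%N -> s (pt P i) = s (pt P 0).
  elim: i => // i IH il; rewrite -IH; last by lia.
  by apply/esym/sE; exists i.
by move=> _ _ [i /= il <-] [j /= jl <-]; rewrite !s0.
Qed.

Lemma path_ends_vertices (V : Type) (P : gpath V) :
  pvertices P (psource P) /\ pvertices P (ptarget P).
Proof. by split; [exists 0%N|exists (plen P)] => //=. Qed.

Lemma pedges_vertices (V : Type) (P : gpath V) e : pedges P e ->
  e `<=` pvertices P.
Proof. by move=> [i /= il <-] x [->|->]; [exists i|exists i.+1] => //=; lia. Qed.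

Lemma finite_pedges (V : Type) (P : gpath V) : finite_set (pedges P).
Proof. exact/finite_image/finite_II. Qed.

Definition edge_disjoint_paths (G : graph) (a b : G) (Q : nat -> gpath G) :=
  [/\ forall j, psource (Q j) = a /\ ptarget (Q j) = b,
      forall j, pedges (Q j) `<=` edges G &
      forall i j e, pedges (Q i) e -> pedges (Q j) e -> i = j].

(** Greedy choice: the finitely many edges of the paths found so far are deleted before the next
    path is taken. *)
Lemma infinitely_connected_disjoint_paths (G : graph) (a b : G) :
  infinitely_edge_connected G -> a <> b ->
  exists Q, edge_disjoint_paths a b Q.
Proof.
move=> [_ conn] ab.
(* The conditions on [F] are put under the existential so that [choice] gives a total function; for
   other [F] any path serves. *)
have ex (F : set (set G)) : exists P : gpath G,
    F `<=` edges G -> finite_set F ->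
    [/\ psource P = a, ptarget P = b & pedges P `<=` edges G `\` F].
  have [[FE fF]|nF] := pselect (F `<=` edges G /\ finite_set F).
    by have [P PP] := conn a b ab F FE fF; exists P.
  have [P _] := conn a b ab set0 (@sub0set _ _) (finite_set0 _).
  by exists P => FE fF; case: nF.
have [q qP] := choice ex.
pose F := fix F n := if n is m.+1 then F m `|` pedges (q (F m)) else set0.
have FP n : F n `<=` edges G /\ finite_set (F n).
  elim: n => [|n [FE fF]] /=; first by split => //; exact: finite_set0.
  have [_ _ qE] := qP _ FE fF; split.
    by rewrite subUset; split=> // e /qE [].
  by rewrite finite_setU; split=> //; exact: finite_pedges.
have F_mono n m : (n <= m)%N -> F n `<=` F m.
  move=> /subnKC<-; elim: (m - n)%N => [|d IH]; first by rewrite addn0.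
  by rewrite addnS => e /IH ?; left.
have disj i j e : (i < j)%N -> pedges (q (F i)) e -> ~ pedges (q (F j)) e.
  move=> ij ei; have [FE fF] := FP j; have [_ _ qE] := qP _ FE fF.
  by move=> /qE [_]; apply; apply: F_mono ij _ _; right.
exists (fun n => q (F n)); split.
- by move=> j; have [FE fF] := FP j; have [] := qP _ FE fF.
- move=> j e; have [FE fF] := FP j; have [_ _ qE] := qP _ FE fF.
  by move=> /qE [].
- move=> i j e ei ej; have [ij|ji|//] := ltngtP i j.
    by case: (disj _ _ _ ij ei).
  by case: (disj _ _ _ ji ej).
Qed.

(** * Excluding one graph as a topological minor *)

Section NonMinor.
Variables (R : realType) (L c : nat -> nat).
Hypothesis LS : forall n, L n.+1 = (L n * c n)%N.
Hypothesis c_gt1 : forall n, (1 < c n)%N.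

Let G : graph := farey_graph R L.

(** Arbitrarily late [m] are required since the images of [a] and [b] may appear at any level. The
    range of [j] consists of two blocks of [m.+1 * L m + 1] indices. *)
Lemma farey_minor_free (H : graph) (a b : H) (Q : nat -> gpath H) :
  a <> b -> edge_disjoint_paths a b Q ->
  (forall n, exists2 m, (n <= m)%N & forall j,
    (j <= (m.+1 * L m).*2.+1)%N -> (plen (Q j) + 3 <= c m)%N) ->
  ~ topological_minor H G.
Proof.
move=> ab [Qends QE Qdisj] big [X [[phi [P [phi_inj P_ends P_disj _ XE]]]]].
case=> f [f_inj fE].
pose g h : G := f (phi h).
have g_inj : injective g by move=> x y /f_inj /phi_inj.
have PX e d : pedges (P e) d -> edges X d by rewrite XE; exists e.
have ga_gb : g a <> g b by move=> /g_inj.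
have [na an] := nodes_cover (g a); have [nb bn] := nodes_cover (g b).
have [m nm mQ] := big (maxn na nb).
pose N := (m.+1 * L m)%N.
pose low (d : set G) := exists2 n, (n <= m)%N & level n d.
pose good j := forall (e : edges H) d,
  pedges (Q j) (val e) -> pedges (P e) d -> ~ low (f @` d).
(* The paths [Q j] are edge-disjoint and there are at most [N] low edges, so
   among any [N.+1] of them one has an image without low edges. *)
have pigeon s : exists2 j, (s <= j <= s + N)%N & good j.
  apply: contrapT => nogood.
  (* A low edge is coded by its level [n <= m] and its index, below [L n <= L m]: [N] codes for
     [N.+1] paths. *)
  have bad (j : 'I_N.+1) : exists t : 'I_m.+1 * 'I_(L m),
      exists e : edges H, exists d, [/\ pedges (Q (s + j)) (val e),
        pedges (P e) d & f @` d = [set node R L t.1 t.2; node R L t.1 t.2.+1]].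
    apply: contrapT => nt; apply: nogood; exists (s + j)%N.
      by have := ltn_ord j; lia.
    move=> e d eQ dP [n nm' [k /= kL E]].
    have kLm : (k < L m)%N by rewrite (leq_trans kL) // (L_mono LS).
    have nm1 : (n < m.+1)%N by [].
    apply: nt; exists (Ordinal nm1, Ordinal kLm), e, d; split=> //.
  have [t tP] := choice bad.
  have t_inj : injective t.
    move=> j j' tE; apply: val_inj => /=.
    have [e [d [eQ dP fd]]] := tP j; have [e' [d' [eQ' dP' fd']]] := tP j'.
    have dd : d = d'.
      by apply: (injective_image f_inj); rewrite fd fd' tE.
    have ee : e = e'.
      by apply: (subdivision_edge_inj phi_inj P_ends P_disj dP); rewrite dd.
    by rewrite -ee in eQ'; have := Qdisj _ _ _ eQ eQ'; lia.
  by have := leq_card t t_inj; rewrite card_prod !card_ord ltnn.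
(* A path of [G] without low edges cannot jump over a node of level [m.+1]. *)
have visit j p : good j -> nodes m.+1 p ->
    (coord (g a) < coord p)%R != (coord (g b) < coord p)%R ->
    exists e : edges H, pedges (Q j) (val e) /\
      exists2 x, pvertices (P e) x & f x = p.
  move=> jgood pm /eqP sep; apply: contrapT => nvis; apply: sep.
  have [<- <-] := Qends j.
  have [sv tv] := path_ends_vertices (Q j).
  (* The side of [p] is constant along [Q j] once it is constant along [P e] for each edge [e] of
     [Q j]; hence two uses of [path_invariant]. *)
  apply: (path_invariant (s := fun h => (coord (g h) < coord p)%R) _ sv tv).
  move=> x y xy; have eH := QE _ _ xy.
  pose e : edges H := SigSub (mem_set eH).
  have Pv h : [set x; y] h -> pvertices (P e) (phi h).
    move=> hxy; have : pends (P e) (phi h) by rewrite P_ends; exists h.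
    by have [? ?] := path_ends_vertices (P e); case=> ->.
  apply: (path_invariant (s := fun z => (coord (f z) < coord p)%R) (P := P e));
    [|by apply: Pv; left|by apply: Pv; right].
  move=> u v uv; have uvG : edges G (f @` [set u; v]) by apply/fE/PX/uv.
  have := jgood e _ xy uv; case: uvG => n _; rewrite image_setU !image_set1 => uvn.
  move=> nlow; have mn : (m < n)%N.
    by rewrite ltnNge; apply/negP => ?; apply: nlow; exists n.
  have pv w : pvertices (P e) w -> p <> f w.
    by move=> wP pw; apply: nvis; exists e; split=> //; exists w.
  rewrite /= (level_side LS c_gt1 mn uvn pm) //.
    by apply/pv/(pedges_vertices uv); left.
  by apply/pv/(pedges_vertices uv); right.
(* Disjoint blocks of indices make [j1] and [j2] distinct. *)
have [j1 /andP[_ j1N] good1] := pigeon 0; rewrite add0n in j1N.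
have [j2 /andP[j2N j2N'] good2] := pigeon N.+1.
have branch p : nodes m.+1 p ->
    (coord (g a) < coord p)%R != (coord (g b) < coord p)%R ->
    exists s : 'I_(plen (Q j1)).+1, g (pt (Q j1) s) = p.
  move=> pm sep; have [e [eQ [x xP xp]]] := visit _ _ good1 pm sep.
  have [e' [eQ' [x' xP' xp']]] := visit _ _ good2 pm sep.
  have xx : x = x' by apply: f_inj; rewrite xp xp'.
  have ee : e <> e'.
    by move=> ee; rewrite -ee in eQ'; have := Qdisj _ _ _ eQ eQ'; lia.
  rewrite -xx in xP'.
  have [h he xh] := subdivision_branch P_ends P_disj ee xP xP'.
  have [i /= il ih] := pedges_vertices eQ he.
  by exists (Ordinal il); rewrite /= ih /g -xh.
have am : nodes m (g a) by apply: (nodes_sub LS c_gt1) an; lia.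
have bm : nodes m (g b) by apply: (nodes_sub LS c_gt1) bn; lia.
pose q i t := node R L m.+1 (i * c m + t).
(* [k0] is the smaller index of the two images at level [m]; the inner fractions of the interval
   starting there separate them. *)
have [k0 k0L sep] : exists2 k, (k < L m)%N & forall t, (0 < t < c m)%N ->
    (coord (g a) < coord (q k t))%R != (coord (g b) < coord (q k t))%R.
  have main i i' : (i < i')%N -> (i' <= L m)%N -> forall t, (0 < t < c m)%N ->
      (coord (node R L m i) < coord (q i t))%R /\
      (coord (node R L m i') < coord (q i t))%R = false.
    move=> ii iL t tc; have iL' : (i < L m)%N by lia.
    rewrite /q (nodeS R LS c_gt1 iL) (nodeS R LS c_gt1 (ltnW iL')).
    have kb := child_bound LS iL'.
    have i1 := leq_mul2r (c m) i.+1 i'; rewrite ii orbT mulSn in i1.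
    have i2 := leq_mul2r (c m) i' (L m); rewrite iL orbT -LS in i2.
    by split; rewrite ?coord_lt //; lia.
  case: am bm => [i /= iL Ei] [i' /= iL' Ei']; rewrite -Ei -Ei'.
  have [lt|lt|E] := ltngtP i i'.
  - exists i; first by lia.
    by move=> t tc; have [-> ->] := main _ _ lt iL' t tc.
  - exists i'; first by lia.
    by move=> t tc; have [-> ->] := main _ _ lt iL t tc.
  - by case: ga_gb; rewrite -Ei -Ei' E.
have kb := child_bound LS k0L.
have ex (t : 'I_(c m).-1) : exists s : 'I_(plen (Q j1)).+1,
    g (pt (Q j1) s) = q k0 t.+1.
  have tc := ltn_ord t; apply: branch; last by apply: sep; lia.
  by exists (k0 * c m + t.+1)%N => //=; lia.
have [s sP] := choice ex.
have s_inj : injective s.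
  move=> t t' E; apply: val_inj => /=.
  have := sP t; rewrite E sP => /node_inj.
  have := ltn_ord t; have := ltn_ord t'; lia.
(* The [c m - 1] separating fractions inject into the [plen (Q j1) + 1] vertices of [Q j1], against
   [plen (Q j1) + 3 <= c m]. *)
have := leq_card s s_inj; rewrite !card_ord.
by have := mQ j1; rewrite -/N; lia.
Qed.

End NonMinor.

(** * Diagonalisation over the countable family *)

Lemma path_length_bounds (H : set graph) : countable H ->
  (forall X : graph, H X -> infinitely_edge_connected X) ->
  exists D : nat -> nat -> nat, forall X : graph, H X ->
    exists i (a b : X) Q,
      [/\ a <> b, edge_disjoint_paths a b Q & forall j, (plen (Q j) <= D i j)%N].
Proof.
move=> /countable_injP[code code_inj] conn.
have ex i : exists d : nat -> nat, forall X : graph, H X -> code X = i ->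
    exists (a b : X) Q,
      [/\ a <> b, edge_disjoint_paths a b Q & forall j, (plen (Q j) <= d j)%N].
  have [[X [HX Xi]]|none] := pselect (exists X, H X /\ code X = i); last first.
    by exists (fun=> 0%N) => X HX Xi; case: none; exists X.
  have cX := conn X HX; have [[a [b ab]] _] := cX.
  have [Q QP] := infinitely_connected_disjoint_paths cX ab.
  exists (fun j => plen (Q j)) => Y HY Yi.
  have YX : Y = X by apply: code_inj; rewrite ?inE // Yi.
  by subst Y; exists a, b, Q.
have [D DP] := choice ex; exists D => X HX.
by exists (code X); apply: DP.
Qed.

Theorem theorem3p1 (R : realType) (H : set graph)
    (countH : countable H)
    (connH : forall X : graph, H X -> infinitely_edge_connected X) :
  exists G : graph,
    [/\ outerplanar R G,
        infinitely_edge_connected G,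
        (forall X : graph, H X -> ~ topological_minor X G) &
        generalised_halved_Farey G].
Proof.
have [D DP] := path_length_bounds countH connH.
(* The maximum covers the codes up to [m] and, for [N = L m], the path indices needed in
   [farey_minor_free]; the [3] is the margin there and also gives [1 < c n]. *)
pose width m N :=
  (3 + \max_(i < m.+1) \max_(j < (m.+1 * N).*2.+2) D i j)%N.
pose L := fix L n := if n is m.+1 then (L m * width m (L m))%N else 1%N.
pose c m := width m (L m).
have LS n : L n.+1 = (L n * c n)%N by [].
have L0 : L 0 = 1%N by [].
have c_gt1 n : (1 < c n)%N by [].
exists (farey_graph R L); split.
- exact: (farey_outerplanar R LS c_gt1).
- exact: (farey_connected R LS c_gt1 L0).
- move=> X HX; have [i [a [b [Q [ab QP QD]]]]] := DP X HX.
  apply: (farey_minor_free LS c_gt1 ab QP) => n.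
  (* At least [i], so that the paths of [X] are counted in the width. *)
  exists (maxn n i) => [|j jN]; first exact: leq_maxl.
  rewrite addnC /c /width leq_add2l (leq_trans (QD j)) //.
  have im : (i < (maxn n i).+1)%N by rewrite ltnS leq_maxr.
  apply: leq_trans (leq_bigmax (Ordinal im)).
  exact: (leq_bigmax (F := fun k : 'I__ => D i k) (Ordinal (jN : (j < _.+1)%N))).
- exact: (farey_generalised R LS c_gt1 L0).
Qed.
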